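(* Let $\mathbb{F}_q$ be the finite field of order $q$, let $m_1,\dots,m_\ell$ be positive integers coprime to $q$, and let $n=m_1+\cdots+m_\ell$. Let $\Lambda=(\lambda_1,\dots,\lambda_\ell)$ and $\Omega=(\omega_1,\dots,\omega_\ell)$, where all $\lambda_i,\omega_i$ are nonzero elements of $\mathbb{F}_q$. Let $\mathcal{C}$ be a linear code of length $n$ over $\mathbb{F}_q$ that is both a $\Lambda$-multi-twisted and an $\Omega$-multi-twisted code. Let $\mathcal{I}_{\Lambda,\Omega}=\{i:1\le i\le\ell,\ \lambda_i\ne\omega_i\}$ and $\mathcal{J}_{\mathcal{C}}=\{i:1\le i\le\ell,\ \pi_i(\mathcal{C})\ne\{0\}\}$. If $\mathcal{I}_{\Lambda,\Omega}\cap\mathcal{J}_{\mathcal{C}}$ is non-empty, then $$\dim_{\mathbb{F}_q}\mathcal{C}\ge\max_{i\in\mathcal{I}_{\Lambda,\Omega}\cap\mathcal{J}_{\mathcal{C}}}\{m_i\}.$$ As a consequence, if $\lambda_i\ne\omega_i$ and $\pi_i(\mathcal{C})\ne\{0\}$ for $1\le i\le\ell$, then $\dim_{\mathbb{F}_q}\mathcal{C}\ge\max\{m_1,m_2,\dots,m_\ell\}$.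
   Context: Vectors of $\mathbb{F}_q^n$ are written $c=(c_{1,0},\dots,c_{1,m_1-1};\dots;c_{\ell,0},\dots,c_{\ell,m_\ell-1})$. For $\Lambda=(\lambda_1,\dots,\lambda_\ell)$ with nonzero entries, a linear code $\mathcal{C}\subseteq\mathbb{F}_q^n$ is a $\Lambda$-multi-twisted code if $c\in\mathcal{C}$ implies $T_\Lambda(c)=(\lambda_1c_{1,m_1-1},c_{1,0},\dots,c_{1,m_1-2};\dots;\lambda_\ell c_{\ell,m_\ell-1},c_{\ell,0},\dots,c_{\ell,m_\ell-2})\in\mathcal{C}$. The map $\pi_i$ is the projection of $\mathbb{F}_q^n$ onto the $i$-th block of coordinates, $\pi_i(c)=(c_{i,0},\dots,c_{i,m_i-1})\in\mathbb{F}_q^{m_i}$ (equivalently the projection of $\prod_{j}\mathbb{F}_q[x]/\langle x^{m_j}-\lambda_j\rangle$ onto its $i$-th factor). *)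

(* Defs.v *)
From HB Require Import structures.
From mathcomp Require Import all_boot all_order all_algebra.

Set Implicit Arguments.
Unset Strict Implicit.
Unset Printing Implicit Defensive.

Import GRing.Theory.
Local Open Scope ring_scope.

(* A vector of F^n, n = \sum_i m i, is a row vector made of the blocks *)
(* submxrow c i = (c_{i,0}, ..., c_{i,m_i-1}), as in \mxrow_i; block i has *)
(* index i : 'I_ell, i.e. blocks are numbered from 0. *)

(* (u_0, ..., u_{k-1}) |-> (a * u_{k-1}, u_0, ..., u_{k-2}): the index *)
(* ord_pred j is j - 1 for j > 0 and k - 1 for j = 0. *)
Definition const_shift (F : fieldType) (k : nat) (a : F) (u : 'rV[F]_k)
    : 'rV[F]_k :=
  \row_(j < k) if val j == 0%N then a * u 0 (ord_pred j) else u 0 (ord_pred j).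

Definition mt_shift (F : fieldType) (ell : nat) (m : 'I_ell -> nat)
    (Lambda : 'I_ell -> F) (c : 'rV[F]_(\sum_(i < ell) m i))
    : 'rV[F]_(\sum_(i < ell) m i) :=
  \mxrow_(i < ell) const_shift (Lambda i) (submxrow c i).

Definition multi_twisted (F : fieldType) (ell : nat) (m : 'I_ell -> nat)
    (Lambda : 'I_ell -> F) (C : {vspace 'rV[F]_(\sum_(i < ell) m i)}) : Prop :=
  forall c, c \in C -> mt_shift Lambda c \in C.

Definition block_proj (F : fieldType) (ell : nat) (m : 'I_ell -> nat)
    (i : 'I_ell) : 'Hom('rV[F]_(\sum_(j < ell) m j), 'rV[F]_(m i)) :=
  linfun (fun c : 'rV[F]_(\sum_(j < ell) m j) => submxrow c i).

(* linfun f agrees with f only when f is linear, which is the case here. *)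
Lemma block_projE (F : fieldType) (ell : nat) (m : 'I_ell -> nat)
    (i : 'I_ell) (c : 'rV[F]_(\sum_(j < ell) m j)) :
  block_proj F m i c = submxrow c i.
Proof.
pose f (c : 'rV[F]_(\sum_(j < ell) m j)) := submxrow c i.
have f_lin : linear f by move=> a u v; apply/rowP=> j; rewrite !mxE.
pose M := GRing.isLinear.Build _ _ _ _ f f_lin.
pose g : {linear _ -> _} := HB.pack f M.
exact: (lfunE g c).
Qed.

Definition diff_blocks (F : fieldType) (ell : nat) (Lambda Omega : 'I_ell -> F)
    : {set 'I_ell} :=
  [set i | Lambda i != Omega i].

Definition supp_blocks (F : fieldType) (ell : nat) (m : 'I_ell -> nat)
    (C : {vspace 'rV[F]_(\sum_(i < ell) m i)}) : {set 'I_ell} :=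
  [set i | (block_proj F m i @: C)%VS != 0%VS].

(* Main.v *)
(* On a block where a = lambda_i and b = omega_i differ, the projection V of C
   is stable under both shifts, and their difference at u is
   (a - b) u_{m_i-1} e_0. Shifting a nonzero vector of V moves a nonzero
   coordinate to the last place, so V contains e_0, hence all its shifts e_j:
   V is the whole space, and dim C >= dim V = m_i. *)
Require Import Defs.
From mathcomp Require Import all_boot all_order all_algebra.

Set Implicit Arguments.
Unset Strict Implicit.
Unset Printing Implicit Defensive.

Import GRing.Theory.
Local Open Scope ring_scope.

Lemma const_shift_succ (F : fieldType) (k : nat) (a : F) (u : 'rV[F]_k)
    (i j : 'I_k) : i = j.+1 :> nat -> const_shift a u 0 i = u 0 j.
Proof.
move=> ij; rewrite mxE [val i]ij /=; congr (u 0 _); apply: val_inj => /=.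
(* The value of [ord_pred i] is [(i + k).-1] modulo [k], which is [j + k] modulo [k] here. *)
by rewrite ij addSn /= modnDr modn_small.
Qed.

Lemma const_shift_first (F : fieldType) (k : nat) (a : F) (u : 'rV[F]_k.+1) :
  const_shift a u 0 ord0 = a * u 0 ord_max.
Proof.
rewrite mxE /=; congr (a * u 0 _); apply: val_inj => /=.
by rewrite modn_small.
Qed.

(** The constant only touches the entry that wraps around to place 0; all other entries cancel. *)
Lemma const_shiftB (F : fieldType) (k : nat) (a b : F) (u : 'rV[F]_k.+1) :
  const_shift a u - const_shift b u = ((a - b) * u 0 ord_max) *: delta_mx 0 ord0.
Proof.
apply/rowP => -[[|j] ltj]; rewrite [in LHS]mxE [X in _ + X = _]mxE.
  rewrite (_ : Ordinal ltj = ord0); last exact: val_inj.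
  by rewrite !const_shift_first !mxE !eqxx mulr1 mulrBl.
rewrite !(@const_shift_succ _ _ _ _ _ (Ordinal (ltnW ltj))) // subrr.
by rewrite !mxE andbF mulr0.
Qed.

(** Since [j] is not the last index, the entry that wraps around is zero and [a] leaves no trace. *)
Lemma const_shift_delta (F : fieldType) (k : nat) (a : F) (i j : 'I_k) :
  i = j.+1 :> nat -> const_shift a (delta_mx 0 j) = delta_mx 0 i.
Proof.
case: k i j => [[]//|k] i j ij; apply/rowP => -[[|l] ltl].
  rewrite (_ : Ordinal ltl = ord0); last exact: val_inj.
  rewrite const_shift_first !mxE !eqxx -!val_eqE /= ij.
  by rewrite gtn_eqF ?mulr0 // -ltnS -ij ltn_ord.
rewrite (@const_shift_succ _ _ _ _ _ (Ordinal (ltnW ltl))) //.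
by rewrite !mxE eqxx -!val_eqE /= ij eqSS.
Qed.

Lemma const_shift_stable_full (F : fieldType) (k : nat) (a b : F)
    (V : {vspace 'rV[F]_k}) :
  a != b -> V != 0%VS ->
  {in V, forall u, const_shift a u \in V} ->
  {in V, forall u, const_shift b u \in V} -> V = fullv.
Proof.
case: k V => [|k] V neq_ab V_neq0 Va Vb.
  (* In length 0 every vector is zero, against [V != 0]. *)
  case/eqP: V_neq0; apply/eqP; rewrite -subv0; apply/subvP => u _.
  by rewrite thinmx0 mem0v.
have [u Vu u_last] : exists2 u, u \in V & u 0 ord_max != 0.
  have /rV0Pn[j uj] : vpick V != 0 by rewrite vpick0.
  (* Induction on the distance [d] from a nonzero coordinate [j] to the last place [k]. The vector
     is generalized, as each step replaces it by its shift. *)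
  move dE: (k - j)%N (memv_pick V) uj => d.
  elim: d j (vpick V) dE => [|d IHd] j u djk Vu uj.
    exists u => //; suff -> : ord_max = j by [].
    apply: val_inj; apply/eqP => /=.
    by rewrite eqn_leq -subn_eq0 djk eqxx -ltnS ltn_ord.
  have ltjk : (j < k)%N by rewrite -subn_gt0 djk.
  have iS : (inord j.+1 : 'I_k.+1) = j.+1 :> nat by rewrite inordK.
  apply: (IHd (inord j.+1) (const_shift a u)).
  - by rewrite iS subnS djk.
  - exact: Va.
  - by rewrite (const_shift_succ _ _ iS).
have Ve0 : delta_mx 0 ord0 \in V.
  have := memvB (Va _ Vu) (Vb _ Vu).
  (* The scalar [(a - b) * u 0 ord_max] is nonzero, so it can be divided out. *)
  rewrite const_shiftB rpredZeq mulf_eq0 subr_eq0.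
  by rewrite (negPf neq_ab) (negPf u_last).
have Ve (j : 'I_k.+1) : delta_mx 0 j \in V.
  case: j; elim=> [|j IHj] ltj.
    by rewrite (_ : Ordinal ltj = ord0) //; apply: val_inj.
  by rewrite -(@const_shift_delta _ _ a _ (Ordinal (ltnW ltj))) //; apply/Va/IHj.
apply/vspaceP => v; rewrite memvf (row_sum_delta v).
by apply: memv_suml => j _; apply/memvZ/Ve.
Qed.

Lemma block_proj_mt_shift (F : fieldType) (ell : nat) (m : 'I_ell -> nat)
    (Lambda : 'I_ell -> F) (i : 'I_ell) (c : 'rV[F]_(\sum_(j < ell) m j)) :
  block_proj F m i (mt_shift Lambda c) =
  const_shift (Lambda i) (block_proj F m i c).
Proof. by rewrite !block_projE /mt_shift mxrowK. Qed.

(** The projection intertwines the shift of the whole vector with that of the block, so stability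
    passes to the image. *)
Lemma multi_twisted_block_proj (F : fieldType) (ell : nat) (m : 'I_ell -> nat)
    (Lambda : 'I_ell -> F) (C : {vspace 'rV[F]_(\sum_(j < ell) m j)})
    (i : 'I_ell) :
  multi_twisted Lambda C ->
  {in (block_proj F m i @: C)%VS, forall u,
    const_shift (Lambda i) u \in (block_proj F m i @: C)%VS}.
Proof.
move=> CL _ /memv_imgP[c Cc ->].
by rewrite -block_proj_mt_shift memv_img // CL.
Qed.

Lemma leq_block_dim (F : fieldType) (ell : nat) (m : 'I_ell -> nat)
    (Lambda Omega : 'I_ell -> F) (C : {vspace 'rV[F]_(\sum_(j < ell) m j)})
    (i : 'I_ell) :
  multi_twisted Lambda C -> multi_twisted Omega C ->
  Lambda i != Omega i -> (block_proj F m i @: C)%VS != 0%VS ->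
  (m i <= \dim C)%N.
Proof.
(* Rank-nullity for the projection restricted to [C]: the image dimension is one of two summands of
   [\dim C]. *)
move=> CL CO neq_i Ci; rewrite -(limg_ker_dim (block_proj F m i) C).
have -> : (block_proj F m i @: C)%VS = fullv.
  by apply: (const_shift_stable_full neq_i Ci); apply: multi_twisted_block_proj.
by rewrite dimvf dim_matrix mul1r leq_addl.
Qed.

Theorem theorem5p4 (F : finFieldType) (q : nat) (hq : #|F| = q)
    (ell : nat) (m : 'I_ell -> nat)
    (m_gt0 : forall i : 'I_ell, (0 < m i)%N)
    (m_coprime : forall i : 'I_ell, coprime (m i) q)
    (Lambda Omega : 'I_ell -> F)
    (Lambda_neq0 : forall i : 'I_ell, Lambda i != 0)
    (Omega_neq0 : forall i : 'I_ell, Omega i != 0)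
    (C : {vspace 'rV[F]_(\sum_(i < ell) m i)})
    (C_Lambda : multi_twisted Lambda C)
    (C_Omega : multi_twisted Omega C) :
  (diff_blocks Lambda Omega :&: supp_blocks C != set0 ->
     (\max_(i in diff_blocks Lambda Omega :&: supp_blocks C) m i <= \dim C)%N)
  /\
  ((forall i : 'I_ell,
      Lambda i != Omega i /\ (block_proj F m i @: C)%VS != 0%VS) ->
     (\max_(i < ell) m i <= \dim C)%N).
Proof.
(* A maximum is bounded term by term, so both claims reduce to a single block. *)
split=> [_|Call]; apply/bigmax_leqP => i.
  by rewrite !inE => /andP[]; apply: leq_block_dim.
by move=> _; have [] := Call i; apply: leq_block_dim.
Qed.
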